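(* Let $G$ be a locally finite connected graph with base vertex $e$, and let $f$ be a Floyd function with $\sum_{n=1}^\infty n f(n)<\infty$. Let $P=(p(v,w))_{v,w\in G}$ be the transition matrix of a uniformly irreducible random walk $(Z_n)_{n\ge0}$ on $G$ with uniform first moment and with spectral radius $\rho(P)<1$. Then $Z_n$ converges almost surely (in the Floyd compactification $\bar G$ associated with $f$) to a random point $\xi$ of the Floyd boundary $\partial_f G$.
   Context: $G$ also denotes the vertex set; $v\sim w$ means $v,w$ are adjacent; $d$ is the graph distance; $e\in G$ is a fixed vertex and $|v|=d(e,v)$. Floyd function: a function $f:\{0,1,2,\dots\}\to(0,\infty)$ such that there is a constant $\lambda>0$ with $\lambda f(r)\le f(r+1)\le f(r)$ for every integer $r>0$, and $\sum_{r=0}^\infty f(r)<\infty$. Floyd boundary: an edge $[v,w]$ gets length $f(|[v,w]|)$, where $|[v,w]|=\min\{|v|,|w|\}$. A path $\alpha=(x_1,\dots,x_n)$ (consecutive vertices adjacent) has Floyd length $L_f(\alpha)=\sum_{i=1}^{n-1} f(|[x_i,x_{i+1}]|)$, and $d_f(v,w)=\inf_\alpha L_f(\alpha)$ over all paths $\alpha$ connecting $v$ and $w$. $\bar G$ is the metric completion of $(G,d_f)$ (the Floyd compactification), and $\partial_f G=\bar G\setminus G$ is the Floyd boundary. Random walk: the walk may start at any vertex; $p^{(n)}(v,w)$ are the entries of $P^n$. Uniformly irreducible: there are $c_0>0$ and $K>0$ such that for all $v\sim w$ there is an integer $\kappa<K$ with $p^{(\kappa)}(v,w)\ge c_0$.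 Spectral radius: $\rho(P)=\limsup_{n\to\infty}p^{(n)}(v,w)^{1/n}$ (independent of $v,w$ by irreducibility). Uniform first moment: $\overline m=\sum_{n=1}^\infty\phi(n)<\infty$, where $\phi(n)=\sup_{v\in G}\sigma_v([n,\infty))$ and $\sigma_v(n)=\sum_{w:d(v,w)=n}p(v,w)$ is the step length distribution at $v$. *)

(* Defs.v *)
From HB Require Import structures.
From mathcomp Require Import all_boot all_order all_algebra generic_quotient.
From mathcomp Require Import lra.
From mathcomp Require Import all_classical all_reals all_analysis.

Set Implicit Arguments.
Unset Strict Implicit.
Unset Printing Implicit Defensive.

Import Order.TTheory GRing.Theory Num.Theory.
Import numFieldNormedType.Exports.

Local Open Scope classical_set_scope.
Local Open Scope ring_scope.
Local Open Scope quotient_scope.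

Lemma cauchy_seq_ballP (R : realType) (T : pseudoMetricType R) (x : nat -> T) :
  cauchy (x @ \oo) <-> (forall e : R, 0 < e ->
    exists N, forall m n, (N <= m)%N -> (N <= n)%N -> ball (x m) e (x n)).
Proof.
rewrite -cauchy_ballP; split.
- move=> cx e e0; have [/= [A B] [[N1 _ A1] [N2 _ B2]] AB] := cx _ e0.
  exists (maxn N1 N2) => m n; rewrite !geq_max => /andP[m1 _] /andP[_ n2].
  exact: AB (x m, x n) (conj (A1 _ m1) (B2 _ n2)).
- move=> cx e e0; have [N xN] := cx _ e0.
  exists (x @` [set n | (N <= n)%N], x @` [set n | (N <= n)%N]) => /=.
    by split; exists N => // n /= Nn; exists n.
  by move=> [a b] [/= [m Nm <-] [n Nn <-]]; exact: xN.
Qed.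

Lemma cauchy_seqP (R : realType) (M : metricType R) (x : nat -> M) :
  cauchy (x @ \oo) <-> (forall e : R, 0 < e ->
    exists N, forall m n, (N <= m)%N -> (N <= n)%N -> mdist (x m) (x n) < e).
Proof.
rewrite cauchy_seq_ballP; split=> cx e /cx[N xN]; exists N => m n Nm Nn;
  by have := xN _ _ Nm Nn; rewrite ballEmdist.
Qed.

Section completion.
Context {R : realType} (M : metricType R).

Definition is_cauchy_seq (x : nat -> M) : bool := `[< cauchy (x @ \oo) >].

Definition cauchy_seq : Type := {x : nat -> M | is_cauchy_seq x}.
HB.instance Definition _ := Choice.on cauchy_seq.

Implicit Types x y z : cauchy_seq.

Definition seq_dist x y : R ^nat := fun n => mdist (val x n) (val y n).

Lemma cvg_seq_dist x y : cvgn (seq_dist x y).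
Proof.
apply/cauchy_cvgP/cauchy_seq_ballP => e e0.
have e20 : 0 < e / 2 by rewrite divr_gt0.
have [N1 H1] := (cauchy_seqP _).1 (asboolW (valP x)) _ e20.
have [N2 H2] := (cauchy_seqP _).1 (asboolW (valP y)) _ e20.
exists (maxn N1 N2) => m n; rewrite !geq_max => /andP[m1 m2] /andP[n1 n2].
have {}H1 := H1 _ _ m1 n1; have {}H2 := H2 _ _ m2 n2.
rewrite -ball_normE/= /seq_dist.
have t1 := metric_triangle (val x m) (val x n) (val y m).
have t2 := metric_triangle (val x n) (val y n) (val y m).
have t3 := metric_triangle (val x n) (val x m) (val y n).
have t4 := metric_triangle (val x m) (val y m) (val y n).
rewrite (metric_sym (val x n) (val x m)) in t3.
rewrite (metric_sym (val y n) (val y m)) in t2.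
rewrite ltr_norml (splitr e); apply/andP; split; lra.
Qed.

Definition seq_lim_dist x y : R := limn (seq_dist x y).

Lemma seq_lim_distxx x : seq_lim_dist x x = 0.
Proof.
rewrite /seq_lim_dist (_ : seq_dist x x = cst 0) ?lim_cst//.
by apply/funext => n; rewrite /seq_dist mdistxx.
Qed.

Lemma seq_lim_dist_sym x y : seq_lim_dist x y = seq_lim_dist y x.
Proof.
by rewrite /seq_lim_dist; congr (limn _); apply/funext => n; exact: metric_sym.
Qed.

Lemma seq_lim_dist_triangle y x z :
  seq_lim_dist x z <= seq_lim_dist x y + seq_lim_dist y z.
Proof.
rewrite /seq_lim_dist -limD; [|exact: cvg_seq_dist..].
apply: ler_lim; [exact: cvg_seq_dist| |].
  by apply: is_cvgD; exact: cvg_seq_dist.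
by apply: nearW => n; exact: metric_triangle.
Qed.

Lemma seq_lim_dist_ge0 x y : 0 <= seq_lim_dist x y.
Proof.
apply: limr_ge; first exact: cvg_seq_dist.
by apply: nearW => n; exact: mdist_ge0.
Qed.

Definition cauchy_equiv : rel cauchy_seq := fun x y => seq_lim_dist x y == 0.

Lemma cauchy_equiv_refl : reflexive cauchy_equiv.
Proof. by move=> x; rewrite /cauchy_equiv seq_lim_distxx. Qed.

Lemma cauchy_equiv_sym : symmetric cauchy_equiv.
Proof. by move=> x y; rewrite /cauchy_equiv seq_lim_dist_sym. Qed.

Lemma cauchy_equiv_trans : transitive cauchy_equiv.
Proof.
move=> y x z /eqP xy /eqP yz; rewrite /cauchy_equiv eq_le seq_lim_dist_ge0 andbT.
by rewrite (le_trans (seq_lim_dist_triangle y x z))// xy yz addr0.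
Qed.

Canonical cauchy_equiv_rel := EquivRel cauchy_equiv cauchy_equiv_refl
  cauchy_equiv_sym cauchy_equiv_trans.

Definition completion : Type := {eq_quot cauchy_equiv}.
HB.instance Definition _ := Choice.on completion.

Definition completion_dist (a b : completion) : R :=
  seq_lim_dist (repr (a : {eq_quot cauchy_equiv}))
               (repr (b : {eq_quot cauchy_equiv})).

Lemma completion_distxx a : completion_dist a a = 0.
Proof. exact: seq_lim_distxx. Qed.

Lemma completion_dist_positivity a b : completion_dist a b = 0 -> a = b.
Proof.
move=> ab0; rewrite -[a]reprK -[b]reprK.
by apply/eqmodP; rewrite /= /cauchy_equiv; apply/eqP.
Qed.

Lemma completion_dist_sym a b : completion_dist a b = completion_dist b a.
Proof. exact: seq_lim_dist_sym. Qed.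

Lemma completion_dist_triangle b a c :
  completion_dist a c <= completion_dist a b + completion_dist b c.
Proof. exact: seq_lim_dist_triangle. Qed.

HB.instance Definition _ := isMetric.Build R completion completion_distxx
  completion_dist_positivity completion_dist_sym completion_dist_triangle.

Lemma is_cauchy_cst (v : M) : is_cauchy_seq (cst v).
Proof.
apply/asboolP/cauchy_seqP => e e0; exists 0%N => m n _ _.
by rewrite mdistxx.
Qed.

Definition to_completion (v : M) : completion :=
  \pi_{eq_quot cauchy_equiv} (Sub (cst v) (is_cauchy_cst v) : cauchy_seq).

Lemma completion_dist_pi x y :
  mdist (\pi_{eq_quot cauchy_equiv} x : completion)
        (\pi_{eq_quot cauchy_equiv} y : completion) = seq_lim_dist x y.
Proof.
have E z : seq_lim_dist (repr (\pi_{eq_quot cauchy_equiv} z)) z = 0.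
  by have /eqmodP/eqP := reprK (\pi_{eq_quot cauchy_equiv} z).
have H z t : seq_lim_dist z t <= seq_lim_dist
    (repr (\pi_{eq_quot cauchy_equiv} z)) (repr (\pi_{eq_quot cauchy_equiv} t)).
  have := seq_lim_dist_triangle (repr (\pi_{eq_quot cauchy_equiv} z)) z t.
  have := seq_lim_dist_triangle (repr (\pi_{eq_quot cauchy_equiv} t))
    (repr (\pi_{eq_quot cauchy_equiv} z)) t.
  by rewrite (seq_lim_dist_sym z (repr _)) !E; lra.
apply/eqP; rewrite eq_le H andbT /mdist/= /completion_dist.
have := seq_lim_dist_triangle x (repr (\pi_{eq_quot cauchy_equiv} x))
  (repr (\pi_{eq_quot cauchy_equiv} y)).
have := seq_lim_dist_triangle y x (repr (\pi_{eq_quot cauchy_equiv} y)).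
by rewrite (seq_lim_dist_sym y (repr _)) !E; lra.
Qed.

Lemma to_completion_isometry v w :
  mdist (to_completion v) (to_completion w) = mdist v w.
Proof.
rewrite completion_dist_pi /seq_lim_dist.
by rewrite (_ : seq_dist _ _ = cst (mdist v w)) ?lim_cst.
Qed.

Lemma to_completion_approx (a : completion) (e : R) : 0 < e ->
  exists v, mdist a (to_completion v) < e.
Proof.
move=> e0; have e20 : 0 < e / 2 by rewrite divr_gt0.
rewrite -[a]reprK; set x := repr _.
have [N xN] := (cauchy_seqP _).1 (asboolW (valP x)) _ e20.
exists (val x N); rewrite completion_dist_pi.
apply: (@le_lt_trans _ _ (e / 2)); last by lra.
apply: limr_le; first exact: cvg_seq_dist.
by exists N => // n /= Nn; exact/ltW/xN.
Qed.

Lemma dense_to_completion : dense (range to_completion).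
Proof.
move=> U [a Ua] Uo; have /nbhs_ballP[e /= e0 eU] := open_nbhs_nbhs (conj Uo Ua).
have [v va] := to_completion_approx a e0.
by exists (to_completion v); split; [apply: eU; rewrite ballEmdist|exists v].
Qed.

Lemma completion_cauchy_cvg (F : set_system completion) :
  ProperFilter F -> cauchy F -> exists a : completion, F --> a.
Proof.
move=> FF cF.
have /choice[v Fv] n : exists v : M,
    F [set b | mdist (to_completion v) b < n.+1%:R^-1].
  have e0 : 0 < n.+1%:R^-1 / 2 :> R by rewrite divr_gt0.
  have [a Fa] := (cauchyP F).1 cF _ e0.
  have [v va] := to_completion_approx a e0; exists v.
  apply: filterS Fa => b; rewrite ballEmdist/= => ab.
  have := metric_triangle (to_completion v) a b.
  move: va ab; rewrite (metric_sym (to_completion v) a) /=.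
  by move: (n.+1%:R^-1) => c; lra.
have vv N n m : (N <= n)%N -> (N <= m)%N -> mdist (v n) (v m) < 2 / N.+1%:R.
  move=> Nn Nm; have [b [bn bm]] := filter_ex (filterI (Fv n) (Fv m)).
  have hn : n.+1%:R^-1 <= N.+1%:R^-1 :> R by rewrite lef_pV2 ?posrE// ler_nat.
  have hm : m.+1%:R^-1 <= N.+1%:R^-1 :> R by rewrite lef_pV2 ?posrE// ler_nat.
  rewrite -to_completion_isometry.
  have := metric_triangle (to_completion (v n)) b (to_completion (v m)).
  rewrite (metric_sym b); move: hn hm bn bm => /=.
  by move: (n.+1%:R^-1) (m.+1%:R^-1) (N.+1%:R^-1) => c1 c2 c3; lra.
have inv0 (e : R) : 0 < e -> exists N, 3 / N.+1%:R < e.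
  move=> e0; exists (Num.truncn (3 / e)); rewrite ltr_pdivrMr// mulrC -ltr_pdivrMr//.
  by rewrite truncnS_gt// divr_ge0// ltW.
have cv : is_cauchy_seq v.
  apply/asboolP/cauchy_seqP => e /inv0[N Ne]; exists N => m n Nm Nn.
  apply: lt_trans (vv N m n Nm Nn) _; apply: le_lt_trans Ne.
  by rewrite ler_pM2r ?invr_gt0// ler_nat.
exists (\pi_{eq_quot cauchy_equiv} (Sub v cv : cauchy_seq) : completion).
move=> A /nbhs_ballP[e /= /inv0[N Ne] eA]; apply: filterS (Fv N) => b vb.
apply: eA; rewrite ballEmdist/=.
apply: le_lt_trans (metric_triangle _ (to_completion (v N)) b) _.
have E (c : R) : 3 * c = 2 * c + c by lra.
apply: lt_trans Ne; rewrite E; apply: ler_ltD => //.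
rewrite completion_dist_pi.
apply: limr_le; first exact: cvg_seq_dist.
exists N => // n /= Nn; rewrite /seq_dist !SubK.
exact/ltW/(vv N).
Qed.

End completion.

(* Loops are allowed: they affect none of the notions below. *)
Record graph := Graph {
  vertex :> choiceType;
  adj : rel vertex;
  adj_sym : symmetric adj;
  adj_locally_finite : forall v, finite_set [set w | adj v w];
  adj_connected : forall v w, exists s, path adj v s /\ last v s = w
}.

(* The path (x_1, ..., x_n) is encoded by its first vertex x_1 and the sequence
   [:: x_2; ...; x_n]. *)
Definition paths (G : graph) (v w : G) : set (seq G) :=
  [set s | path (@adj G) v s /\ last v s = w].

Section graph_distance.
Context {G : graph}.

Let has_path_of_size (v w : G) : pred nat :=
  fun n => `[< exists2 s, paths v w s & size s = n >].

Fact graph_dist_subproof (v w : G) : exists n, has_path_of_size v w n.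
Proof.
by have [s sP] := adj_connected v w; exists (size s); apply/asboolP; exists s.
Qed.

Definition graph_dist (v w : G) : nat := ex_minn (graph_dist_subproof v w).

End graph_distance.

Record floyd_function (R : realType) := FloydFunction {
  floyd_fun :> nat -> R;
  floyd_fun_gt0 : forall r, 0 < floyd_fun r;
  floyd_fun_ratio : exists2 lambda : R, 0 < lambda &
    forall r, (0 < r)%N ->
      lambda * floyd_fun r <= floyd_fun r.+1 /\ floyd_fun r.+1 <= floyd_fun r;
  floyd_fun_summable : cvgn (series floyd_fun)
}.

Section floyd_distance.
Context {R : realType} (G : graph) (e : G) (f : floyd_function R).

Definition edge_length (v w : G) : R :=
  f (minn (graph_dist e v) (graph_dist e w)).

Definition floyd_length (v : G) (s : seq G) : R :=
  \sum_(l <- pairmap edge_length v s) l.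

Definition floyd_dist (v w : G) : R := inf [set floyd_length v s | s in paths v w].

Lemma edge_length_gt0 v w : 0 < edge_length v w.
Proof. exact: floyd_fun_gt0. Qed.

Lemma floyd_length_cons v w s :
  floyd_length v (w :: s) = edge_length v w + floyd_length w s.
Proof. by rewrite /floyd_length /= big_cons. Qed.

Lemma floyd_length_ge0 v s : 0 <= floyd_length v s.
Proof.
elim: s v => [|w s IH] v; first by rewrite /floyd_length big_nil.
by rewrite floyd_length_cons addr_ge0// ltW// edge_length_gt0.
Qed.

Lemma floyd_length_cat v s t :
  floyd_length v (s ++ t) = floyd_length v s + floyd_length (last v s) t.
Proof. by rewrite /floyd_length pairmap_cat big_cat. Qed.

Lemma floyd_length_rev v w s : paths v w s ->
  exists2 t, paths w v t & floyd_length w t = floyd_length v s.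
Proof.
elim: s v => [|x s IH] v [/= sp sw]; first by exists [::]; rewrite -?sw.
case/andP: sp => vx xs; have [t [tp tx] tl] := IH x (conj xs sw).
exists (rcons t v).
  by split; rewrite ?last_rcons// rcons_path tp tx adj_sym.
rewrite -cats1 floyd_length_cat tx tl !floyd_length_cons addrC.
by rewrite /floyd_length big_nil addr0 /edge_length minnC.
Qed.

Lemma floyd_dist_le v w s : paths v w s -> floyd_dist v w <= floyd_length v s.
Proof.
move=> sP; apply: ge_inf; last by exists s.
by exists 0 => _ [t _ <-]; exact: floyd_length_ge0.
Qed.

Lemma floyd_dist_ge v w (a : R) :
  (forall s, paths v w s -> a <= floyd_length v s) -> a <= floyd_dist v w.
Proof.
move=> H; apply: lb_le_inf; last by move=> _ [t tP <-]; exact: H.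
by have [s sP] := adj_connected v w; exists (floyd_length v s), s.
Qed.

Lemma floyd_distxx v : floyd_dist v v = 0.
Proof.
apply/eqP; rewrite eq_le; apply/andP; split; last first.
  by apply: floyd_dist_ge => s _; exact: floyd_length_ge0.
have /floyd_dist_le : paths v v [::] by [].
by rewrite /floyd_length big_nil.
Qed.

Lemma floyd_dist_sym v w : floyd_dist v w = floyd_dist w v.
Proof.
wlog suff : v w / floyd_dist v w <= floyd_dist w v.
  by move=> H; apply/eqP; rewrite eq_le !H.
apply: floyd_dist_ge => s /floyd_length_rev[t tP <-]; exact: floyd_dist_le.
Qed.

Lemma floyd_dist_triangle w v x :
  floyd_dist v x <= floyd_dist v w + floyd_dist w x.
Proof.
rewrite -lerBlDr; apply: floyd_dist_ge => s [sp sw].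
rewrite lerBlDr -lerBlDl; apply: floyd_dist_ge => t [tp tx].
rewrite lerBlDl -sw -floyd_length_cat; apply: floyd_dist_le.
by split; rewrite ?cat_path ?last_cat sw ?sp.
Qed.

(* The first edge of a path leaving v has length f k for some k <= |v|. *)
Lemma floyd_dist_positivity v w : floyd_dist v w = 0 -> v = w.
Proof.
move=> vw0; apply/eqP/negPn/negP => vw.
pose a := \big[Num.min/f 0]_(k < (graph_dist e v).+1) f k.
have a0 : 0 < a.
  by rewrite /a; elim/big_ind: _ => [||k _]; rewrite ?floyd_fun_gt0// => x y x0 y0;
     rewrite lt_min x0.
suff : a <= 0 by rewrite leNgt a0.
rewrite -vw0; apply: floyd_dist_ge => -[[_ /= vwE]|x s _].
  by rewrite vwE eqxx in vw.
rewrite floyd_length_cons (@le_trans _ _ (edge_length v x))//; last first.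
  by rewrite lerDl floyd_length_ge0.
have h : (minn (graph_dist e v) (graph_dist e x) < (graph_dist e v).+1)%N.
  by rewrite ltnS geq_minl.
by rewrite /a (bigD1 (Ordinal h))//= ge_min lexx.
Qed.

Definition floyd_space : Type := G.
HB.instance Definition _ := Choice.on floyd_space.
HB.instance Definition _ := isMetric.Build R floyd_space floyd_distxx
  floyd_dist_positivity floyd_dist_sym floyd_dist_triangle.

Definition floyd_compactification : metricType R := completion floyd_space.

Definition floyd_embedding (v : G) : floyd_compactification :=
  to_completion (v : floyd_space).

Definition floyd_boundary : set floyd_compactification :=
  ~` range floyd_embedding.

End floyd_distance.

Section random_walk.
Context {R : realType} {G : graph}.
Local Open Scope ereal_scope.

Definition transition_matrix (p : G -> G -> R) : Prop :=
  (forall v w, (0 <= p v w)%R) /\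
  (forall v, \esum_(w in [set: G]) (p v w)%:E = 1).

Variable p : G -> G -> R.

(* The entries of P^n, summed in the extended reals. *)
Fixpoint nstep (n : nat) (v w : G) : \bar R :=
  if n is m.+1 then \esum_(u in [set: G]) ((p v u)%:E * nstep m u w)
  else ((v == w)%:R)%:E.

Definition uniformly_irreducible : Prop :=
  exists (c0 : R) (K : nat), [/\ (0 < c0)%R, (0 < K)%N &
    forall v w, adj v w -> exists2 k, (k < K)%N & c0%:E <= nstep k v w].

Definition spectral_radius (v w : G) : \bar R :=
  limn_esup (fun n => nstep n v w `^ (n%:R^-1)).

Definition step_length (v : G) (n : nat) : \bar R :=
  \esum_(w in [set w | graph_dist v w = n]) (p v w)%:E.

Definition step_tail (n : nat) : \bar R :=
  ereal_sup [set \sum_(n <= k <oo) step_length v k | v in [set: G]].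

Definition uniform_first_moment : Prop :=
  \sum_(1 <= n <oo) step_tail n < +oo.

(* Z is a Markov chain with transition probabilities p, started at x0: the
   events {Z_n = v} are measurable and
   P(Z_0 = x_0, ..., Z_n = x_n) = 1_{x_0 = x0} p(x_0,x_1) ... p(x_(n-1),x_n). *)
Definition random_walk d (Omega : measurableType d) (Pr : probability Omega R)
    (x0 : G) (Z : nat -> Omega -> G) : Prop :=
  (forall n v, measurable (Z n @^-1` [set v])) /\
  (forall n (x : nat -> G),
    Pr [set om | forall i, (i <= n)%N -> Z i om = x i] =
    ((x 0%N == x0)%:R * \prod_(i < n) p (x i) (x i.+1))%:E).

End random_walk.

Definition borel_measurable d (Omega : measurableType d) (T : topologicalType)
    (X : Omega -> T) : Prop :=
  forall B, <<s [set U : set T | open U] >> B -> measurable (X @^-1` B).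

(* Main.v *)
Require Import Defs.
From HB Require Import structures.
From mathcomp Require Import all_boot all_order all_algebra.
From mathcomp Require Import ring zify.
From mathcomp Require Import all_classical all_reals all_analysis.

Set Implicit Arguments.
Unset Strict Implicit.
Unset Printing Implicit Defensive.

Import Order.TTheory GRing.Theory Num.Theory.
Import numFieldNormedType.Exports.

Local Open Scope classical_set_scope.
Local Open Scope ring_scope.

(** Two facts about the walk, almost sure for a suitable integer L > 0, force
    convergence: for all large n,

      |Z_n| >= 2 n / L   and   d(Z_n, Z_(n+1)) <= n / L.

    Every vertex of a geodesic from Z_n to Z_(n+1) is then at distance at least
    m = floor (n / L) from the base vertex, so that the Floyd distance from Z_n
    to Z_(n+1) is at most m f(m). Each m occurs for L values of n and
    sum m f(m) converges, hence (Z_n) is Cauchy and has a limit in the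
    completion. Every vertex is isolated for the Floyd distance and |Z_n| tends
    to infinity, hence the limit lies in the boundary ([ballistic_cvg]).

    Linear escape ([linear_escape]). Let G_n(x, y) = sum_(k >= n) p^(k)(x, y).
    Since the spectral radius is smaller than 1 and the chain is irreducible,
    p^(n)(x0, e) <= C q^n for some q < 1 and all large n, so that G_n(x0, e) is
    at most a constant times q^n. By uniform irreducibility there is c > 0 such
    that the walk started at u with |u| <= r is at e with probability at least
    c^r at some time that depends on u only. By Chapman-Kolmogorov,
    c^r P(|Z_n| <= r) <= G_n(x0, e). For r = 2 n / L with L large this makes
    P(|Z_n| <= r) exponentially small in n, and the Borel-Cantelli lemma
    applies. No bound on vertex degrees and no reversibility is needed.

    Small jumps ([jump_summable]). By the Markov property,
    P(d(Z_n, Z_(n+1)) > n / L) <= phi(floor (n / L) + 1), and the sum over n of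
    the right-hand side is L times the first moment, hence finite; the
    Borel-Cantelli lemma applies again.

    Both facts are events expressed with countably many of the discrete
    variables Z_n, so they define a measurable set of full measure; the limit
    on that set, completed by a constant boundary point, is Borel
    ([borel_measurable_lim]). *)

(** * Sums of nonnegative families *)

Lemma esumZl (R : realType) (T : choiceType) (I : set T) (a : T -> \bar R)
    (r : R) : 0 <= r -> (forall i, I i -> (0 <= a i)%E) ->
  (\esum_(i in I) (r%:E * a i) = r%:E * \esum_(i in I) a i)%E.
Proof.
move=> r0 a0; rewrite esum_mkcond [in RHS]esum_mkcond /esum -ereal_supZl//; last first.
  by apply/set0P; exists 0%E, set0; [split|rewrite fsbig_set0].
congr ereal_sup; rewrite image_comp; apply: eq_imagel => A [fA _] /=.
rewrite ge0_mule_fsumr; last by move=> i; case: ifPn => // /set_mem/a0.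
by apply: eq_fsbigr => i _; case: ifP; rewrite ?mule0.
Qed.

Lemma esumZr (R : realType) (T : choiceType) (I : set T) (a : T -> \bar R)
    (r : R) : 0 <= r -> (forall i, I i -> (0 <= a i)%E) ->
  (\esum_(i in I) (a i * r%:E) = (\esum_(i in I) a i) * r%:E)%E.
Proof.
by move=> r0 a0; under eq_esum do rewrite muleC; rewrite esumZl// muleC.
Qed.

Lemma exchange_esum (R : realType) (T1 T2 : choiceType) (a : T1 -> T2 -> \bar R) :
  (forall i j, (0 <= a i j)%E) ->
  (\esum_(i in [set: T1]) \esum_(j in [set: T2]) a i j =
   \esum_(j in [set: T2]) \esum_(i in [set: T1]) a i j)%E.
Proof.
move=> a0; rewrite !esum_esum//.
rewrite (reindex_esum ([set: T2] `*`` (fun=> [set: T1])) _ (fun k => (k.2, k.1)))//.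
by split=> // [[i j] [k l] _ _ [-> ->]//|[i j] _]; exists (j, i).
Qed.

Lemma esum_ge_term (R : realType) (T : choiceType) (a : T -> \bar R) (t : T) :
  (0 <= a t)%E -> (a t <= \esum_(i in [set: T]) a i)%E.
Proof.
by move=> at0; apply: esum_ge; exists [set t]; [split|rewrite fsbig_set1].
Qed.

Lemma esum_delta (R : realType) (T : choiceType) (a : T -> \bar R) (t : T) :
  (0 <= a t)%E -> (\esum_(i in [set: T]) ((t == i)%:R%:E * a i) = a t)%E.
Proof.
move=> at0; rewrite -[RHS](esum_set1 at0) [RHS]esum_mkcond.
apply: eq_esum => i _; case: (eqVneq t i) => [->|ti].
  by rewrite mem_set// mul1e.
by rewrite memNset ?mul0e// => it; rewrite it eqxx in ti.
Qed.

(** * Powers of a stochastic matrix *)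

Section nstep.
Context {R : realType} {G : graph} (p : G -> G -> R).
Hypothesis pT : transition_matrix p.
Local Open Scope ereal_scope.

Let p_ge0 v w : (0 <= p v w)%R. Proof. by have [] := pT. Qed.

Let p_sum v : \esum_(w in [set: G]) (p v w)%:E = 1.
Proof. by have [] := pT. Qed.

Lemma nstep_ge0 n v w : 0 <= nstep p n v w.
Proof.
elim: n v => [|n IH] v /=; first by rewrite lee_fin ler0n.
by apply: esum_ge0 => u _; rewrite mule_ge0 ?lee_fin.
Qed.

Lemma nstep_le1 n v w : nstep p n v w <= 1.
Proof.
elim: n v => [|n IH] v /=; first by rewrite lee_fin lern1 leq_b1.
rewrite -(p_sum v).
by apply: le_esum => u _; rewrite -[leRHS]mule1 lee_wpmul2l ?lee_fin.
Qed.

Lemma nstep_fin_num n v w : nstep p n v w \is a fin_num.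
Proof.
by rewrite ge0_fin_numE ?nstep_ge0// (le_lt_trans (nstep_le1 _ _ _))// ltry.
Qed.

Lemma nstep_sum_le1 n v : \esum_(w in [set: G]) nstep p n v w <= 1.
Proof.
elim: n v => [|n IH] v /=.
  by under eq_esum do rewrite -[_%:E]mule1; rewrite (@esum_delta _ _ (fun=> 1)).
rewrite exchange_esum; last by move=> *; rewrite mule_ge0 ?lee_fin ?nstep_ge0.
rewrite -(p_sum v).
apply: le_esum => u _; rewrite esumZl//; last by move=> *; exact: nstep_ge0.
by rewrite -[leRHS]mule1 lee_wpmul2l ?lee_fin.
Qed.

(** The Chapman-Kolmogorov equation. *)
Lemma nstepD m n v w :
  nstep p (m + n) v w = \esum_(u in [set: G]) (nstep p m v u * nstep p n u w).
Proof.
have n0 k x y : nstep p k x y = (fine (nstep p k x y))%:E.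
  by rewrite fineK ?nstep_fin_num.
elim: m v => [|m IH] v.
  by rewrite (@esum_delta _ _ (fun u => nstep p n u w)) ?nstep_ge0.
rewrite addSn /=; under eq_esum => u _ do
  (rewrite IH -esumZl; [|exact: p_ge0|by move=> *; rewrite mule_ge0 ?nstep_ge0]).
rewrite exchange_esum; last first.
  by move=> *; rewrite !mule_ge0 ?lee_fin ?nstep_ge0.
apply: eq_esum => z _; rewrite (n0 n) -esumZr ?fine_ge0 ?nstep_ge0//.
  by apply: eq_esum => u _; rewrite muleA.
by move=> *; rewrite mule_ge0 ?lee_fin ?nstep_ge0.
Qed.

Lemma nstepD_ge m n v u w :
  nstep p m v u * nstep p n u w <= nstep p (m + n) v w.
Proof.
rewrite nstepD; apply: (@esum_ge_term _ _ (fun u => nstep p m v u * nstep p n u w)).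
by rewrite mule_ge0 ?nstep_ge0.
Qed.

(** If every edge is crossed with probability at least c at some fixed time,
    then the end of a path of length at most m is reached from its start with
    probability at least c ^ m at some fixed time. *)
Lemma nstep_path (c : R) : (0 <= c <= 1)%R ->
  (forall v w, adj v w -> exists k, c%:E <= nstep p k v w) ->
  forall s v m, path (@adj G) v s -> (size s <= m)%N ->
  exists k, (c ^+ m)%:E <= nstep p k v (last v s).
Proof.
move=> /andP[c0 c1] cP; elim=> [|w s IH] v m /=.
  by move=> _ _; exists 0%N; rewrite /= eqxx lee_fin exprn_ile1.
case: m => // m /andP[/cP[k1 k1P]] /IH/[apply] -[k2 k2P]; exists (k1 + k2)%N.
apply: le_trans (nstepD_ge _ _ _ w _).
by rewrite exprS EFinM; apply: lee_pmul => //; rewrite lee_fin ?exprn_ge0.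
Qed.

End nstep.

(** * Graph distance *)

Section graph_dist.
Context {G : graph}.
Implicit Types v w x : G.

Lemma graph_dist_path v w :
  exists2 s, paths v w s & size s = graph_dist v w.
Proof.
by rewrite /graph_dist; case: ex_minnP => n /asboolP[s sP <-] _; exists s.
Qed.

Lemma graph_dist_le v w s : paths v w s -> (graph_dist v w <= size s)%N.
Proof.
move=> sP; rewrite /graph_dist; case: ex_minnP => n _; apply.
by apply/asboolP; exists s.
Qed.

Lemma graph_dist_triangle x v w :
  (graph_dist v w <= graph_dist v x + graph_dist x w)%N.
Proof.
have [s [sp sx] <-] := graph_dist_path v x.
have [t [tp tw] <-] := graph_dist_path x w.
rewrite -size_cat; apply: graph_dist_le.
by split; rewrite ?cat_path ?last_cat sx ?sp.
Qed.

Lemma graph_dist_adj v w : adj v w -> (graph_dist v w <= 1)%N.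
Proof. by move=> vw; apply: (@graph_dist_le _ _ [:: w]); split => //=; rewrite vw. Qed.

Lemma graph_dist_sym v w : graph_dist v w = graph_dist w v.
Proof.
wlog suff : v w / (graph_dist v w <= graph_dist w v)%N.
  by move=> H; apply/eqP; rewrite eqn_leq !H.
have [s [+ +] <-] := graph_dist_path w v.
elim: s w => [|x s IH] w /=; first by move=> _ ->; exact: (@graph_dist_le _ _ [::]).
move=> /andP[wx /IH/[apply] xv].
rewrite (leq_trans (graph_dist_triangle x _ _))// -addn1 leq_add//.
by apply: graph_dist_adj; rewrite adj_sym.
Qed.

Lemma countable_graph (v : G) : countable [set: G].
Proof.
(* B n is the ball of radius n around v, finite by local finiteness. *)
pose B := fix B n : set G :=
  if n is m.+1 then \bigcup_(u in B m) (u |` [set w | adj u w]) else [set v].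
have fB n : finite_set (B n).
  elim: n => [|n IH] /=; first exact: finite_set1.
  apply: bigcup_finite => // u _.
  by rewrite finite_setU; split; [exact: finite_set1|exact: adj_locally_finite].
apply: (@sub_countable _ _ _ (\bigcup_n B n)); last first.
  by apply: bigcup_countable => // n _; exact: finite_set_countable.
apply: subset_card_le => w _.
have [s [sp sw]] := adj_connected v w; exists (size s) => //; rewrite -sw {sw}.
elim/last_ind: s sp => [|s u IH]//; rewrite rcons_path last_rcons size_rcons.
by move=> /andP[/IH Bs su]; exists (last v s) => //; right.
Qed.

End graph_dist.

(** * Floyd distance *)

Section floyd.
Context {R : realType} {G : graph} (e : G) (f : floyd_function R).

Lemma floyd_fun_le m n : (0 < m)%N -> (m <= n)%N -> f n <= f m.
Proof.
move=> m0; elim: n => [|n IH]; first by case: m m0.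
rewrite leq_eqVlt => /predU1P[->//|]; rewrite ltnS => mn.
have [lambda _ fP] := floyd_fun_ratio f.
by have [_ /le_trans] := fP n (leq_trans m0 mn); apply; exact: IH.
Qed.

(** A path from v of length at most |v| - m stays at distance at least m from e,
    so that each of its edges has length at most f m. *)
Lemma floyd_length_le m v s : (0 < m)%N -> path (@adj G) v s ->
  (m + size s <= graph_dist e v)%N -> floyd_length e f v s <= (size s)%:R * f m.
Proof.
move=> m0; elim: s v => [|w s IH] v /=.
  by rewrite /floyd_length big_nil mul0r.
move=> /andP[vw sw] vm.
have vwD : (graph_dist e v <= graph_dist e w + 1)%N.
  rewrite (leq_trans (graph_dist_triangle w _ _))// leq_add2l.
  by apply: graph_dist_adj; rewrite adj_sym.
have wm : (m + size s <= graph_dist e w)%N by lia.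
rewrite floyd_length_cons -natr1 mulrDl mul1r addrC lerD//; first exact: IH.
apply: floyd_fun_le => //; lia.
Qed.

(** A geodesic of length at most m that starts at distance at least 2 m from e
    stays at distance at least m from e. *)
Lemma floyd_dist_step m v w : (0 < m)%N ->
  (2 * m <= graph_dist e v)%N -> (graph_dist v w <= m)%N ->
  floyd_dist e f v w <= m%:R * f m.
Proof.
move=> m0 vm vw; have [s sP ss] := graph_dist_path v w.
apply: le_trans (floyd_dist_le e f sP) _.
apply: le_trans (@floyd_length_le m _ _ m0 (proj1 sP) _) _; first by lia.
by rewrite ler_pM2r ?floyd_fun_gt0// ler_nat ss.
Qed.

(** The Floyd distance is discrete: the first edge of a path leaving v has
    length f k for some k <= |v|. *)
Lemma floyd_dist_lower v : exists2 a : R, 0 < a &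
  forall w, w != v -> a <= floyd_dist e f v w.
Proof.
pose a := \big[Num.min/f 0]_(k < (graph_dist e v).+1) f k.
exists a.
  by rewrite /a; elim/big_ind: _ => [||k _]; rewrite ?floyd_fun_gt0// => x y x0 y0;
     rewrite lt_min x0.
move=> w wv; apply: floyd_dist_ge => -[[_ /= vwE]|x s _].
  by rewrite vwE eqxx in wv.
rewrite floyd_length_cons (@le_trans _ _ (edge_length e f v x))//; last first.
  by rewrite lerDl floyd_length_ge0.
have h : (minn (graph_dist e v) (graph_dist e x) < (graph_dist e v).+1)%N.
  by rewrite ltnS geq_minl.
by rewrite /a (bigD1 (Ordinal h))//= ge_min lexx.
Qed.

Lemma mdist_embedding v w :
  mdist (floyd_embedding e f v) (floyd_embedding e f w) = floyd_dist e f v w.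
Proof. exact: to_completion_isometry. Qed.

(** Every vertex is isolated in the completion, so a convergent sequence that
    eventually avoids each vertex has its limit in the boundary. *)
Lemma floyd_boundary_lim (x : nat -> G) (xi : floyd_compactification e f) :
  (forall v, exists N, forall n, (N <= n)%N -> x n != v) ->
  (fun n => floyd_embedding e f (x n)) @ \oo --> xi ->
  floyd_boundary xi.
Proof.
move=> xv xxi [v _ vxi]; rewrite -{}vxi in xxi.
have [a a0 aP] := floyd_dist_lower v; have [N1 N1P] := xv v.
have [N2 _ N2P] := xxi _ (nbhsx_ballx _ _ a0).
have /= := N2P (maxn N1 N2) (leq_maxr _ _).
by rewrite ballEmdist /= mdist_embedding ltNge aP// N1P// leq_maxl.
Qed.

Lemma floyd_cauchy_cvg (x : nat -> G) (b : nat -> R) (N : nat) :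
  cvgn (series b) ->
  (forall n, (N <= n)%N -> floyd_dist e f (x n) (x n.+1) <= b n) ->
  exists xi : floyd_compactification e f,
    (fun n => floyd_embedding e f (x n)) @ \oo --> xi.
Proof.
move=> bc xb; apply: completion_cauchy_cvg; apply/cauchy_seqP => r r0.
have dS m n : (N <= m)%N -> (m <= n)%N ->
    floyd_dist e f (x m) (x n) <= series b n - series b m.
  move=> Nm; elim: n => [|n IH]; first by rewrite leqn0 => /eqP->; rewrite floyd_distxx subrr.
  rewrite leq_eqVlt => /predU1P[->|]; first by rewrite floyd_distxx subrr.
  rewrite ltnS => mn; apply: le_trans (floyd_dist_triangle e f (x n) _ _) _.
  rewrite seriesSr addrAC lerD ?IH//; apply: xb; exact: leq_trans mn.
have /cauchy_cvgP/cauchy_seq_ballP/(_ _ r0)[M MP] := bc.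
exists (maxn N M) => m n; rewrite !geq_max => /andP[Nm Mm] /andP[Nn Mn].
rewrite mdist_embedding.
wlog mn : m n Nm Mm Nn Mn / (m <= n)%N.
  by move=> H; case: (leqP m n) => [|/ltnW] ?; [|rewrite floyd_dist_sym]; exact: H.
apply: le_lt_trans (dS _ _ Nm mn) _.
by have := MP _ _ Mn Mm; rewrite -ball_normE /= => /(le_lt_trans (ler_norm _)).
Qed.

End floyd.

(** * Markov property of the walk *)

(** A measure is the sum of its restrictions to the fibers of a discrete
    variable. *)
Lemma measure_fibers d (Omega : measurableType d) (R : realType)
    (mu : {measure set Omega -> \bar R}) (T : choiceType) (X : Omega -> T)
    (A : set Omega) :
  countable [set: T] -> (forall t, measurable (X @^-1` [set t])) ->
  measurable A ->
  (mu A = \esum_(t in [set: T]) mu (A `&` X @^-1` [set t]))%E.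
Proof.
move=> /countable_injP[g ginj] mX mA.
have gI : set_inj [set: T] g by [].
pose F i := A `&` (g \o X) @^-1` [set i].
have Fg t : F (g t) = A `&` X @^-1` [set t].
  apply/seteqP; split=> om [Aom /= Xt]; split=> //=; last by rewrite Xt.
  by apply: ginj; rewrite ?inE.
have F0 i : ~ range g i -> F i = set0.
  by move=> gi; rewrite -subset0 => om [_ /= Xi]; apply: gi; exists (X om).
have mF i : measurable (F i).
  have [[t _ <-]|/F0->//] := pselect (range g i).
  by rewrite Fg; exact: measurableI.
have AF : A = \bigcup_i F i.
  by apply/seteqP; split=> [om Aom|om [i _ []//]]; exists (g (X om)).
rewrite [in LHS]AF measure_semi_bigcup//; last 2 first.
- by apply/trivIsetP => i j _ _ ij; rewrite -subset0 => om [[_ /= gi] [_ /= gj]];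
    rewrite -gi gj eqxx in ij.
- by rewrite -AF.
rewrite nneseries_esumT//; under [RHS]eq_esum do rewrite -Fg.
rewrite -(@esum_image _ _ _ _ g (fun i => mu (F i)) gI) [RHS]esum_mkcond.
apply: eq_esum => i _; case: ifPn => // /negP gi.
by rewrite F0 ?measure0// => ?; apply: gi; rewrite inE.
Qed.

Section walk.
Context {R : realType} {G : graph} (p : G -> G -> R).
Hypothesis pT : transition_matrix p.
Context d {Omega : measurableType d} (Pr : probability Omega R) (x0 : G).
Context (Z : nat -> Omega -> G).
Hypothesis ZP : random_walk p Pr x0 Z.

Let p_ge0 v w : 0 <= p v w. Proof. by have [] := pT. Qed.

(** The event that the trajectory starts with x 0, ..., x n. *)
Definition trajectory n (x : nat -> G) : set Omega :=
  [set om | forall i, (i <= n)%N -> Z i om = x i].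

Lemma measurable_walk n v : measurable (Z n @^-1` [set v]).
Proof. by have [] := ZP. Qed.

Lemma measurable_walk_set n (B : set G) : measurable (Z n @^-1` B).
Proof.
rewrite (_ : _ @^-1` _ = \bigcup_v (Z n @^-1` ([set v] `&` B))); last first.
  by apply/seteqP; split=> [om Bom|om [v _ [_]]//]; exists (Z n om).
apply: countable_bigcupT_measurable; first exact: (countable_graph x0).
move=> v; have [Bv|Bv] := pselect (B v).
  rewrite (_ : _ `&` _ = [set v]); first exact: measurable_walk.
  by apply/seteqP; split=> [w [->]//|w ->].
rewrite (_ : _ `&` _ = set0) ?preimage_set0//.
by rewrite -subset0 => w [-> /Bv].
Qed.

Lemma measurable_walk_rel n (B : G -> G -> Prop) :
  measurable [set om | B (Z n om) (Z n.+1 om)].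
Proof.
rewrite (_ : mkset _ = \bigcup_v (Z n @^-1` [set v] `&` Z n.+1 @^-1` (B v))).
  apply: countable_bigcupT_measurable; first exact: (countable_graph x0).
  by move=> v; apply: measurableI; exact: measurable_walk_set.
by apply/seteqP; split=> [om Bom|om [v _ [/= ->]]//]; exists (Z n om).
Qed.

Lemma measurable_trajectory n x : measurable (trajectory n x).
Proof.
rewrite (_ : trajectory n x = \bigcap_(i in `I_n.+1) Z i @^-1` [set x i]).
  by apply: bigcap_measurableType => i _; exact: measurable_walk.
by apply/seteqP; split=> om H i; exact: H.
Qed.

(** The sequence x up to time n, followed by the constant value u; only the
    value at time n + 1 matters below. *)
Definition extend n (x : nat -> G) (u : G) : nat -> G :=
  fun i => if (i <= n)%N then x i else u.

Lemma trajectory_extend n x u :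
  trajectory n.+1 (extend n x u) = trajectory n x `&` Z n.+1 @^-1` [set u].
Proof.
apply/seteqP; split=> [om H|om [H /= Hu] i].
  split=> [i ni|] /=; first by rewrite H ?leqW// /extend ni.
  by rewrite H// /extend ltnn.
rewrite leq_eqVlt /extend => /predU1P[->|]; first by rewrite ltnn.
by rewrite ltnS => ni; rewrite ni; exact: H.
Qed.

Lemma Pr_trajectory_extend n x u :
  (Pr (trajectory n.+1 (extend n x u)) = Pr (trajectory n x) * (p (x n) u)%:E)%E.
Proof.
have [_ PrE] := ZP; rewrite /trajectory !PrE big_ord_recr /= mulrA EFinM.
rewrite /extend leqnn ltnn; congr (_ * _)%:E%E; congr (_ * _).
by apply: eq_bigr => i _; rewrite (ltnW (ltn_ord i)) (ltn_ord i).
Qed.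

Lemma Pr_step n x A : measurable A ->
  (Pr (trajectory n x `&` A) =
    \esum_(u in [set: G]) Pr (trajectory n.+1 (extend n x u) `&` A))%E.
Proof.
move=> mA; rewrite (measure_fibers _ (countable_graph x0) (measurable_walk n.+1)).
  by apply: eq_esum => u _; rewrite trajectory_extend setIAC.
by apply: measurableI => //; exact: measurable_trajectory.
Qed.

(** The Markov property, in the form of a bound. If the conditional probability
    of A given the trajectory up to time m + j is at most h at its last vertex,
    then given the trajectory up to time m it is at most P^j h at its last
    vertex. *)
Lemma markov_le (A : set Omega) (h : G -> R) : measurable A ->
  (forall v, 0 <= h v) -> forall j m,
  (forall x, Pr (trajectory (m + j) x `&` A) <=
    Pr (trajectory (m + j) x) * (h (x (m + j)%N))%:E)%E ->
  forall x, (Pr (trajectory m x `&` A) <= Pr (trajectory m x) *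
    \esum_(u in [set: G]) (nstep p j (x m) u * (h u)%:E))%E.
Proof.
move=> mA h0; elim=> [|j IH] m mP x.
  rewrite /= (@esum_delta _ _ (fun u => (h u)%:E)) ?lee_fin//.
  by have := mP x; rewrite addn0.
have {}IH := IH m.+1; rewrite addSnnS in IH; have {}IH := IH mP.
have s0 i v : (0 <= \esum_(u in [set: G]) (nstep p i v u * (h u)%:E))%E.
  by apply: esum_ge0 => u _; rewrite mule_ge0 ?lee_fin// nstep_ge0.
have nh0 i v u : (0 <= nstep p i v u * (h u)%:E)%E.
  by rewrite mule_ge0 ?lee_fin// nstep_ge0.
rewrite Pr_step//.
apply: (@le_trans _ _ (\esum_(u in [set: G]) (Pr (trajectory m x) *
    ((p (x m) u)%:E * \esum_(z in [set: G]) (nstep p j u z * (h z)%:E))))%E).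
  apply: le_esum => u _; apply: le_trans (IH _) _.
  by rewrite Pr_trajectory_extend /extend ltnn muleA.
rewrite -(fineK (fin_num_measure Pr _ (measurable_trajectory m x))).
rewrite esumZl ?fine_ge0//; last by move=> u _; rewrite mule_ge0 ?lee_fin.
rewrite lee_wpmul2l// ?lee_fin ?fine_ge0//.
under eq_esum => u _ do (rewrite -esumZl; [|exact: p_ge0|by move=> *; exact: nh0]).
rewrite exchange_esum; last by move=> *; rewrite mule_ge0 ?lee_fin.
apply: le_esum => z _ /=; rewrite -esumZr//.
  by under eq_esum do rewrite muleA.
by move=> *; rewrite mule_ge0 ?lee_fin ?nstep_ge0.
Qed.

Lemma markov_start_le (A : set Omega) (h : G -> R) n : measurable A ->
  (forall v, 0 <= h v) ->
  (forall x, Pr (trajectory n x `&` A) <= Pr (trajectory n x) * (h (x n))%:E)%E ->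
  (Pr (Z 0 @^-1` [set x0] `&` A) <=
    \esum_(u in [set: G]) (nstep p n x0 u * (h u)%:E))%E.
Proof.
move=> mA h0 hP; have -> : Z 0 @^-1` [set x0] = trajectory 0 (fun=> x0).
  by apply/seteqP; split=> om => [/= Z0 i|]; [rewrite leqn0 => /eqP->|exact].
apply: le_trans (@markov_le A h mA h0 n 0 hP (fun=> x0)) _.
rewrite -[leRHS]mul1e lee_wpmul2r ?probability_le1//.
  by apply: esum_ge0 => u _; rewrite mule_ge0 ?lee_fin// nstep_ge0.
exact: measurable_trajectory.
Qed.

Lemma walk_start : Pr (~` (Z 0 @^-1` [set x0])) = 0%E.
Proof.
rewrite probability_setC; last exact: measurable_walk.
have -> : Z 0 @^-1` [set x0] = trajectory 0 (fun=> x0).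
  by apply/seteqP; split=> om => [/= Z0 i|]; [rewrite leqn0 => /eqP->|exact].
have [_ PrE] := ZP.
by rewrite /trajectory PrE eqxx big_ord0 mulr1 subee.
Qed.

Lemma Pr_mem_le n (B : set G) :
  (Pr (Z 0 @^-1` [set x0] `&` Z n @^-1` B) <=
    \esum_(u in [set: G]) (nstep p n x0 u * (\1_B u)%:E))%E.
Proof.
apply: markov_start_le => [|//|x]; first exact: measurable_walk_set.
have [Bx|Bx] := pselect (B (x n)).
  rewrite indicE mem_set// mule1 le_measure ?inE//.
  - by apply: measurableI; [exact: measurable_trajectory|exact: measurable_walk_set].
  - exact: measurable_trajectory.
rewrite (_ : _ `&` _ = set0); first by rewrite measure0 mule_ge0.
by rewrite -subset0 => om [/(_ n (leqnn n)) /= ->].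
Qed.

Lemma step_tail_ge v k :
  (\esum_(w in [set w | (k <= graph_dist v w)%N]) (p v w)%:E <= step_tail p k)%E.
Proof.
apply: (@le_trans _ _ (\sum_(k <= j <oo) step_length p v j)%E); last first.
  by apply: ereal_sup_ubound; exists v.
have sl0 j : (0 <= step_length p v j)%E by apply: esum_ge0 => *; rewrite lee_fin.
rewrite ereal_series nneseries_esum//.
rewrite (_ : [set w | _] = \bigcup_(j in [set j | (k <= j)%N])
  [set w | graph_dist v w = j]); last first.
  by apply/seteqP; split=> [w kw|w [j /= kj ->]//]; exists (graph_dist v w).
rewrite esum_bigcupT//.
- by apply/trivIsetP => i j _ _ ij; rewrite -subset0 => w [/= wi wj];
    rewrite -wi wj eqxx in ij.
- by move=> w; rewrite lee_fin.
Qed.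

Lemma step_tail_ge0 k : (0 <= step_tail p k)%E.
Proof.
by apply: le_trans (step_tail_ge x0 k); apply: esum_ge0 => *; rewrite lee_fin.
Qed.

Lemma Pr_jump_le n k : (step_tail p k < +oo)%E ->
  (Pr (Z 0 @^-1` [set x0] `&`
    [set om | (k <= graph_dist (Z n om) (Z n.+1 om))%N]) <= step_tail p k)%E.
Proof.
move=> tk; have tf : step_tail p k \is a fin_num.
  by rewrite ge0_fin_numE// step_tail_ge0.
have mA : measurable [set om | (k <= graph_dist (Z n om) (Z n.+1 om))%N].
  exact: (@measurable_walk_rel n (fun v w => (k <= graph_dist v w)%N)).
apply: le_trans (@markov_start_le _ (fun=> fine (step_tail p k)) n mA _ _) _.
- by move=> _; rewrite fine_ge0// step_tail_ge0.
- move=> x; rewrite Pr_step// fineK//.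
  apply: (@le_trans _ _ (\esum_(u in [set: G]) (Pr (trajectory n x) *
     if u \in [set w | (k <= graph_dist (x n) w)%N] then (p (x n) u)%:E else 0))%E).
    apply: le_esum => u _; case: ifPn => [_|/negP ku].
      rewrite -Pr_trajectory_extend le_measure ?inE//; last first.
        exact: measurable_trajectory.
      by apply: measurableI => //; exact: measurable_trajectory.
    rewrite mule0 (_ : _ `&` _ = set0) ?measure0//.
    rewrite trajectory_extend -subset0 => om [[/(_ n (leqnn n)) + /= ->]].
    by move=> -> kx; apply: ku; rewrite inE.
  rewrite -(fineK (fin_num_measure Pr _ (measurable_trajectory n x))).
  rewrite esumZl ?fine_ge0//; last by move=> u _; case: ifP; rewrite ?lee_fin.
  rewrite lee_wpmul2l ?lee_fin ?fine_ge0// -esum_mkcond; exact: step_tail_ge.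
- rewrite esumZr ?fine_ge0 ?step_tail_ge0//; last by move=> *; exact: nstep_ge0.
  rewrite fineK// -[leRHS]mul1e lee_wpmul2r ?step_tail_ge0//.
  exact: nstep_sum_le1.
Qed.

End walk.

(** * Sums along integer quotients *)

Lemma sum_divn (V : nmodType) (F : nat -> V) (L M : nat) : (0 < L)%N ->
  \sum_(0 <= i < M * L) F (i %/ L)%N = (\sum_(0 <= i < M) F i) *+ L.
Proof.
move=> L0; rewrite big_nat_mul -sumrMnl; apply: eq_bigr => i _.
rewrite (eq_big_nat _ _ (F2 := fun=> F i)); last first.
  by move=> j; rewrite mulnC [(i.+1 * L)%N]mulnC => ij; congr F; apply/eqP; nia.
by rewrite sumr_const_nat mulSn addnK.
Qed.

Lemma nneseries_divn_lty (R : realType) (F : nat -> \bar R) (L : nat) :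
  (0 < L)%N -> (forall n, 0 <= F n)%E -> (\sum_(n <oo) F n < +oo)%E ->
  (\sum_(n <oo) F (n %/ L)%N < +oo)%E.
Proof.
move=> L0 F0 Foo.
have natmulE (x : \bar R) k : (0 <= x)%E -> x *+ k = (k%:R%:E * x)%E.
  move=> x0; elim: k => [|k IH]; first by rewrite mulr0n mul0e.
  by rewrite mulrS IH -natr1 EFinD ge0_muleDl// mul1e addrC.
apply: (@le_lt_trans _ _ (L%:R%:E * \sum_(n <oo) F n)%E); last first.
  by rewrite lte_mul_pinfty.
apply: lime_le; first exact: is_cvg_nneseries.
apply: nearW => n; apply: (@le_trans _ _ (\sum_(0 <= i < n * L) F (i %/ L)%N)%E).
  by apply: lee_sum_nneg_natr => //; rewrite leq_pmulr.
rewrite sum_divn// natmulE ?sume_ge0// lee_wpmul2l//.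
exact: nneseries_lim_ge.
Qed.

Lemma cvg_series_divn (R : realType) (F : nat -> R) (L : nat) :
  (0 < L)%N -> (forall n, 0 <= F n) -> cvgn (series F) ->
  cvgn (series (fun n => F (n %/ L)%N)).
Proof.
move=> L0 F0 Fc; apply: nnseries_is_cvg => //.
apply: (@nneseries_divn_lty _ (fun n => (F n)%:E)) => //.
rewrite (_ : (\sum_(n <oo) (F n)%:E)%E = (limn (series F))%:E) ?ltry//.
by rewrite -EFin_lim//; apply/congr_lim/funext => n /=; rewrite sumEFin.
Qed.

(** * Exponential decay and linear escape *)

Section decay.
Context {R : realType} {G : graph} (p : G -> G -> R).
Hypothesis pT : transition_matrix p.

Lemma spectral_radius_lt1 v w : (spectral_radius p v w < 1)%E ->
  exists2 q : R, 0 < q < 1 & exists N, forall n, (N <= n)%N ->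
    (nstep p n v w <= (q ^+ n)%:E)%E.
Proof.
rewrite /spectral_radius limn_esup_lim (cvg_lim _ (@cvg_esups_inf _ _))//.
move=> /ereal_inf_lt[_ [N _ <-]]; set S := esups _ _ => S1.
have uS n : (N <= n)%N -> (nstep p n v w `^ n%:R^-1 <= S)%E.
  by move=> Nn; apply: ereal_sup_ubound; exists n.
have S0 : (0 <= S)%E by apply: le_trans (uS N (leqnn N)); exact: poweR_ge0.
case: S S0 S1 uS => [r r0 r1 uS|//|//].
exists (Num.max r 2^-1).
  rewrite lte_fin in r1; rewrite lt_max gt_max r1 invr_gt0 ltr0n orbT /=.
  by rewrite invf_lt1 ?ltr1n.
exists (maxn N 1) => n; rewrite geq_max => /andP[/uS + n0].
rewrite -(fineK (nstep_fin_num pT n v w)) poweR_EFin !lee_fin => h.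
set x := fine _ in h *; have x0 : 0 <= x by rewrite fine_ge0// nstep_ge0.
have -> : x = (x `^ n%:R^-1) ^+ n.
  rewrite -powR_mulrn ?powR_ge0// -powRrM mulVf ?powRr1//.
  by rewrite pnatr_eq0 -lt0n.
by apply: lerXn2r; rewrite ?nnegrE ?powR_ge0// ?le_max ?h// invr_ge0 ler0n orbT.
Qed.

Context (c : R) (c01 : 0 < c <= 1).
Hypothesis cP : forall v w, adj v w -> exists k, (c%:E <= nstep p k v w)%E.

Lemma nstep_dist v w m : (graph_dist v w <= m)%N ->
  exists k, ((c ^+ m)%:E <= nstep p k v w)%E.
Proof.
move=> vm; have [s [sp sw] ss] := graph_dist_path v w.
rewrite -sw; apply: (nstep_path pT _ cP sp); last by rewrite ss.
by case/andP: c01 => /ltW-> ->.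
Qed.

(** The rate q does not depend on the pair x, y, unlike the constant: going from
    v to x, then to y, then to w compares p^(n)(x, y) with p^(n+k)(v, w). *)
Lemma nstep_decay v w : (spectral_radius p v w < 1)%E ->
  exists2 q : R, 0 < q < 1 & forall x y, exists2 delta : R, 0 < delta &
    exists N, forall n, (N <= n)%N -> (delta%:E * nstep p n x y <= (q ^+ n)%:E)%E.
Proof.
have [c0 c1] := andP c01.
move=> /spectral_radius_lt1[q q01 [N NP]]; exists q => // x y.
have [k1 k1P] := nstep_dist (leqnn (graph_dist v x)).
have [k2 k2P] := nstep_dist (leqnn (graph_dist y w)).
exists (c ^+ graph_dist v x * c ^+ graph_dist y w); first by rewrite mulr_gt0 ?exprn_gt0.
exists N => n Nn; rewrite EFinM -muleA [X in (_ * X)%E]muleC.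
apply: (@le_trans _ _ (nstep p (k1 + (n + k2)) v w)).
  apply: le_trans (nstepD_ge pT _ _ _ x _); apply: lee_pmul => //.
  - by rewrite lee_fin exprn_ge0// ltW.
  - by rewrite mule_ge0 ?nstep_ge0// lee_fin exprn_ge0// ltW.
  - apply: le_trans (nstepD_ge pT _ _ _ y _).
    by rewrite lee_wpmul2l// nstep_ge0.
apply: le_trans (NP _ _) _; first by lia.
have [q0 q1] := andP q01.
by rewrite lee_fin ler_wiXn2l ?ltW//; lia.
Qed.

Context d {Omega : measurableType d} (Pr : probability Omega R) (x0 : G).
Context (Z : nat -> Omega -> G).
Hypothesis ZP : random_walk p Pr x0 Z.

(** The right-hand side is the expected number of visits to e from time n on.
    Being within distance r of e at time n yields a visit at some time after n,
    or at n itself, with probability at least c ^ r. *)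
Lemma Pr_ball_le (e : G) n r :
  ((c ^+ r)%:E * Pr (Z 0 @^-1` [set x0] `&`
      Z n @^-1` [set u | (graph_dist e u <= r)%N]) <=
   \sum_(k <oo) nstep p (n + k) x0 e)%E.
Proof.
have [c0 c1] := andP c01; set B := [set u | _].
have cr0 : 0 <= c ^+ r by rewrite exprn_ge0// ltW.
rewrite nneseries_esumT; last by move=> *; exact: nstep_ge0.
under eq_esum do rewrite nstepD//.
rewrite exchange_esum; last by move=> *; rewrite mule_ge0 ?nstep_ge0.
apply: (@le_trans _ _ ((c ^+ r)%:E *
    \esum_(u in [set: G]) (nstep p n x0 u * (\1_B u)%:E))%E).
  by rewrite lee_wpmul2l ?lee_fin//; exact: (Pr_mem_le pT ZP).
rewrite -esumZl//; last by move=> *; rewrite mule_ge0 ?nstep_ge0.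
apply: le_esum => u _; rewrite muleCA.
rewrite -(fineK (nstep_fin_num pT n x0 u)) esumZl ?fine_ge0 ?nstep_ge0//; last first.
  by move=> *; exact: nstep_ge0.
rewrite lee_wpmul2l// ?lee_fin ?fine_ge0 ?nstep_ge0//.
have [/set_mem/= ue|uB] := boolP (u \in B); last first.
  rewrite indicE (negbTE uB) mule0; apply: esum_ge0 => *; exact: nstep_ge0.
rewrite indicE mem_set// mule1; rewrite /B /= graph_dist_sym in ue.
have [k kP] := nstep_dist ue; apply: le_trans kP _.
by apply: (@esum_ge_term _ _ (fun k => nstep p k u e)); exact: nstep_ge0.
Qed.

(** The probability that |Z_n| < 2 n / L decays exponentially. *)
Lemma linear_escape (e v w : G) : (spectral_radius p v w < 1)%E ->
  exists2 L : nat, (0 < L)%N & exists C s : R, 0 < s < 1 /\ forall n,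
    (Pr (Z 0 @^-1` [set x0] `&`
      Z n @^-1` [set u | (L * graph_dist e u < 2 * n)%N]) <= (C * s ^+ n)%:E)%E.
Proof.
have [c0 c1] := andP c01.
move=> /nstep_decay[q /andP[q0 q1] /(_ x0 e)[dl dl0 [N NP]]].
pose s := Num.sqrt q.
have s0 : 0 < s by rewrite sqrtr_gt0.
have sq : s ^+ 2 = q by rewrite sqr_sqrtr// ltW.
have s1 : s < 1 by rewrite -(@ltr_pXn2r _ 2)// ?nnegrE ?ltW// sq expr1n.
(* L is chosen so that the factor c ^ (2 n / L) costs at most half of the
   exponential decay rate. *)
have [L L0 Lc] : exists2 L, (0 < L)%N & s ^+ L <= c ^+ 2.
  have : GRing.exp s @ \oo --> 0 by apply: cvg_expr; rewrite gtr0_norm.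
  move=> /cvgrPdist_le/(_ _ (exprn_gt0 2 c0))[L _ LP]; exists L.+1 => //.
  by have := LP L.+1 (leqnSn L); rewrite sub0r normrN ger0_norm// exprn_ge0// ltW.
(* The term s ^- N takes care of the times n < N, where the bound is at
   least 1. *)
exists L => //; pose C := (dl * (1 - q))^-1.
exists (C + s ^- N), s; split=> [|n]; first by rewrite s0.
have C0 : 0 < C by rewrite invr_gt0 mulr_gt0// subr_gt0.
set E := _ `&` _; have mE : measurable E.
  by apply: measurableI; [exact: (measurable_walk ZP)|exact: (measurable_walk_set ZP)].
have [nN|Nn] := ltnP n N.
  apply: le_trans (probability_le1 Pr mE) _; rewrite lee_fin mulrDl.
  rewrite (@le_trans _ _ (s ^- N * s ^+ n))//; last first.
    by rewrite lerDr mulr_ge0 ?exprn_ge0 ?ltW.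
  rewrite mulrC ler_pdivlMr ?exprn_gt0// mul1r.
  by apply: ler_wiXn2l (ltnW nN); exact: ltW.
pose r := (2 * n %/ L)%N.
have sc : s ^+ n <= c ^+ r.
  rewrite -(@ler_pXn2r _ L)// ?nnegrE; [|by rewrite exprn_ge0// ltW..].
  rewrite -!exprM; apply: (@le_trans _ _ (c ^+ (2 * n))).
    by rewrite mulnC !exprM; apply: lerXn2r; rewrite ?nnegrE ?exprn_ge0// ltW.
  by apply: ler_wiXn2l => //; [exact: ltW|exact: leq_trunc_div].
have ZE : E `<=` Z 0 @^-1` [set x0] `&` Z n @^-1` [set u | (graph_dist e u <= r)%N].
  by move=> om [Z0 /= Zn]; split=> //=; rewrite leq_divRL// mulnC ltnW.
have mB : measurable (Z 0 @^-1` [set x0] `&` Z n @^-1` [set u | (graph_dist e u <= r)%N]).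
  by apply: measurableI; [exact: (measurable_walk ZP)|exact: (measurable_walk_set ZP)].
rewrite -(fineK (fin_num_measure Pr _ mE)) lee_fin; set P := fine _.
have P0 : 0 <= P by rewrite fine_ge0.
have h1 : ((s ^+ n)%:E * P%:E <= \sum_(k <oo) nstep p (n + k) x0 e)%E.
  apply: le_trans (Pr_ball_le e n r); apply: lee_pmul => //.
  - by rewrite lee_fin exprn_ge0// ltW.
  - by rewrite fineK ?fin_num_measure// le_measure ?inE.
have h2 : (dl%:E * \sum_(k <oo) nstep p (n + k) x0 e <= (q ^+ n * (1 - q)^-1)%:E)%E.
  rewrite -nneseriesZl; last by move=> *; exact: nstep_ge0.
  apply: lime_le.
    by apply: is_cvg_nneseries => *; rewrite mule_ge0 ?nstep_ge0 ?lee_fin ?ltW.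
  apply: nearW => m; apply: (@le_trans _ _ (\sum_(0 <= i < m) (q ^+ n * q ^+ i)%:E)%E).
    by apply: lee_sum => i _; rewrite -exprD; apply: NP; rewrite (leq_trans Nn)// leq_addr.
  rewrite sumEFin lee_fin; apply: (@geometric_le_lim _ m (q ^+ n) q) => //.
    by rewrite exprn_ge0// ltW.
  by rewrite gtr0_norm.
have h3 : dl * (s ^+ n * P) <= q ^+ n * (1 - q)^-1.
  rewrite -lee_fin; apply: le_trans h2; rewrite EFinM lee_wpmul2l// ?lee_fin ?ltW//.
rewrite (@le_trans _ _ (C * s ^+ n))//; last first.
  by rewrite mulrDl lerDl mulr_ge0 ?invr_ge0 ?exprn_ge0 ?ltW.
have sn0 : 0 < s ^+ n by rewrite exprn_gt0.
have qn : q ^+ n = s ^+ n * s ^+ n by rewrite -{1}sq -exprM mul2n -addnn exprD.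
rewrite -(ler_pM2l (mulr_gt0 dl0 sn0)) -[leLHS]mulrA (le_trans h3)// qn /C.
rewrite le_eqVlt; apply/orP; left; apply/eqP.
by field; rewrite gt_eqF ?subr_gt0//= gt_eqF.
Qed.

End decay.

(** * Limits of discrete variables *)

(** A map that is a pointwise limit on a measurable set D, and is constant off D,
    is Borel. Inverse images of all sets under X n are supposed to be
    measurable, as for a discrete variable; no completeness of the sigma-algebra
    is needed. *)
Lemma borel_measurable_lim d (Omega : measurableType d) (R : realType)
    (T : pseudoMetricType R) (X : nat -> Omega -> T) (xi : Omega -> T) (a : T)
    (D : set Omega) :
  (forall n B, measurable (X n @^-1` B)) -> measurable D ->
  (forall om, D om -> X ^~ om @ \oo --> xi om) ->
  (forall om, ~ D om -> xi om = a) ->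
  borel_measurable xi.
Proof.
move=> mX mD Dxi Da B BP; apply: (BP [set B | measurable (xi @^-1` B)]).
split=> [|U oU /=].
  split=> [|A|F mF] /=.
  - by rewrite preimage_set0.
  - by rewrite setTD preimage_setC => mA; exact: measurableC.
  - by rewrite preimage_bigcup; apply: bigcup_measurable => i _; exact: mF.
(* xi is in U exactly when, for some k, all but finitely many X n have their
   ball of radius 1 / (k + 1) contained in U. *)
pose A k := [set y | ball y k.+1%:R^-1 `<=` U].
have -> : xi @^-1` U =
    (D `&` \bigcup_k \bigcup_N \bigcap_(n in [set n | (N <= n)%N]) X n @^-1` A k)
    `|` (~` D `&` [set _ | U a]).
  apply/seteqP; split=> om.
    move=> /= Uxi; have [Dom|Dom] := pselect (D om); last first.
      by right; split=> //=; rewrite -(Da om Dom).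
    left; split=> //.
    have /nbhs_ballP[r /= r0 rU] : nbhs (xi om) U by exact: open_nbhs_nbhs.
    have r20 : 0 < r / 2 by rewrite divr_gt0.
    exists (Num.truncn (r / 2)^-1) => //.
    have [N _ NP] := Dxi _ Dom _ (nbhsx_ballx (xi om) _ r20).
    exists N => // n /= /NP /= Xn y Xny; apply: rU; rewrite (splitr r).
    apply: ball_triangle Xn _; apply: le_ball Xny.
    by rewrite invf_ple ?posrE//; exact/ltW/truncnS_gt.
  move=> [[Dom [k _ [N _ NP]]]|[Dom /= Ua]]; last by rewrite Da.
  have k0 : 0 < k.+1%:R^-1 :> R by rewrite invr_gt0.
  have [M _ MP] := Dxi _ Dom _ (nbhsx_ballx (xi om) _ k0).
  apply: (NP (maxn N M) (leq_maxl _ _)); apply: ball_sym.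
  exact: MP (leq_maxr _ _).
apply: measurableU; apply: measurableI => //.
- apply: bigcupT_measurable => k; apply: bigcupT_measurable => N.
  by apply: bigcap_measurableType => n _; exact: mX.
- exact: measurableC.
- have [Ua|Ua] := pselect (U a).
    by rewrite (_ : mkset _ = setT)//; apply/seteqP; split.
  by rewrite (_ : mkset _ = set0)//; apply/seteqP; split.
Qed.

(** * Ballistic trajectories converge to the Floyd boundary *)

Section floyd_limit.
Context {R : realType} {G : graph} (e : G) (f : floyd_function R).
Hypothesis f_moment : cvgn (series (fun n : nat => n%:R * f n)).

(** Eventually |x n| >= 2 n / L and the jump at time n is at most n / L. *)
Definition ballistic (L : nat) (x : nat -> G) : Prop :=
  exists N, forall n, (N <= n)%N ->
    (2 * n <= L * graph_dist e (x n))%N /\ (graph_dist (x n) (x n.+1) <= n %/ L)%N.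

Lemma ballistic_cvg (L : nat) (x : nat -> G) : (0 < L)%N -> ballistic L x ->
  exists xi : floyd_compactification e f,
    (fun n => floyd_embedding e f (x n)) @ \oo --> xi /\ floyd_boundary xi.
Proof.
move=> L0 [N NP].
have xL n : (N <= n)%N -> (2 * (n %/ L) <= graph_dist e (x n))%N.
  move=> /NP[h _]; rewrite -(leq_pmul2l L0) (leq_trans _ h)// mulnCA leq_mul2l /=.
  by rewrite mulnC leq_trunc_div.
have [xi xxi] : exists xi : floyd_compactification e f,
    (fun n => floyd_embedding e f (x n)) @ \oo --> xi.
  pose g m : R := m%:R * f m.
  apply: (@floyd_cauchy_cvg _ _ _ _ _ (fun n => g (n %/ L)%N) (maxn N L)).
    apply: cvg_series_divn => // n.
    by rewrite mulr_ge0// ltW// floyd_fun_gt0.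
  move=> n; rewrite geq_max => /andP[Nn Ln]; apply: floyd_dist_step.
  - by rewrite divn_gt0.
  - exact: xL.
  - by have [] := NP _ Nn.
exists xi; split=> //; apply: floyd_boundary_lim xxi => v.
exists (maxn N (L * (graph_dist e v).+1)) => n; rewrite geq_max => /andP[Nn vn].
apply/eqP => xnv; have := xL _ Nn; rewrite xnv leqNgt => /negP; apply.
have : ((graph_dist e v).+1 <= n %/ L)%N by rewrite leq_divRL// mulnC.
lia.
Qed.

End floyd_limit.

(** * The walk is almost surely ballistic *)

Section transience.
Context {R : realType} {G : graph} (e : G) (p : G -> G -> R).
Hypothesis pT : transition_matrix p.
Hypothesis p_irr : uniformly_irreducible p.
Hypothesis p_moment : uniform_first_moment p.
Context (v w : G) (p_radius : (spectral_radius p v w < 1)%E).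
Context d {Omega : measurableType d} (Pr : probability Omega R) (x0 : G).
Context (Z : nat -> Omega -> G).
Hypothesis ZP : random_walk p Pr x0 Z.

Lemma jump_summable (L : nat) : (0 < L)%N ->
  (\sum_(n <oo) Pr (Z 0 @^-1` [set x0] `&`
    [set om | (n %/ L < graph_dist (Z n om) (Z n.+1 om))%N]) < +oo)%E.
Proof.
move=> L0; have tail0 := step_tail_ge0 pT x0.
have tail_lty k : (0 < k)%N -> (step_tail p k < +oo)%E.
  move=> k0; apply: le_lt_trans p_moment.
  apply: le_trans (nneseries_lim_ge k.+1 _) => //.
  by rewrite big_nat_recr//= leeDr// sume_ge0.
have tailS : (\sum_(n <oo) step_tail p n.+1 < +oo)%E.
  apply: le_lt_trans p_moment; apply: lime_le; first exact: is_cvg_nneseries.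
  apply: nearW => n; rewrite -(big_add1 _ _ 0%N n.+1 xpredT).
  exact: nneseries_lim_ge.
apply: le_lt_trans (nneseries_divn_lty L0 (fun n => tail0 n.+1) tailS).
apply: lee_nneseries => // n _; exact: (Pr_jump_le pT ZP _ (tail_lty _ _)).
Qed.

Lemma ae_ballistic : exists2 L : nat, (0 < L)%N &
  exists2 D : set Omega, measurable D /\ Pr (~` D) = 0%E &
    forall om, D om -> ballistic e L (Z ^~ om).
Proof.
have [c0 [K [c00 _ cP]]] := p_irr.
have c01 : 0 < Num.min c0 1 <= 1 by rewrite lt_min c00 ltr01 ge_min lexx orbT.
have {}cP a b : adj a b -> exists k, ((Num.min c0 1)%:E <= nstep p k a b)%E.
  move=> /cP[k _ kP]; exists k; apply: le_trans kP.
  by rewrite lee_fin ge_min lexx.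
have [L L0 [C [s [/andP[s0 s1] escP]]]] := linear_escape pT c01 cP ZP e p_radius.
pose S := Z 0 @^-1` [set x0].
pose F1 n := S `&` Z n @^-1` [set u | (L * graph_dist e u < 2 * n)%N].
pose F2 n := S `&` [set om | (n %/ L < graph_dist (Z n om) (Z n.+1 om))%N].
have mS : measurable S by exact: (measurable_walk ZP).
have mF1 n : measurable (F1 n).
  by apply: measurableI => //; exact: (measurable_walk_set ZP).
have mF2 n : measurable (F2 n).
  apply: measurableI => //.
  exact: (measurable_walk_rel ZP n (fun x y => (n %/ L < graph_dist x y)%N)).
have mlim F : (forall n, measurable (F n)) -> measurable (@lim_sup_set Omega F).
  by move=> mF; apply: bigcapT_measurable => n; exact: bigcup_measurable.
have C0 : 0 <= C.
  by rewrite -lee_fin; have := escP 0%N; rewrite expr0 mulr1; exact: le_trans.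
have F1_0 : Pr (lim_sup_set F1) = 0%E.
  apply: lim_sup_set_cvg0 => //.
  apply: (@le_lt_trans _ _ (\sum_(n <oo) (C * s ^+ n)%:E)%E).
    by apply: lee_nneseries => // n _; exact: escP.
  apply: (@le_lt_trans _ _ (C * (1 - s)^-1)%:E); last exact: ltry.
  apply: lime_le.
    by apply: is_cvg_nneseries => n _ _; rewrite lee_fin mulr_ge0// exprn_ge0// ltW.
  apply: nearW => n; rewrite sumEFin lee_fin; apply: (@geometric_le_lim _ n C s) => //.
  by rewrite gtr0_norm.
have F2_0 : Pr (lim_sup_set F2) = 0%E.
  by apply: lim_sup_set_cvg0 => //; exact: jump_summable.
exists L => //; exists (S `&` ~` lim_sup_set F1 `&` ~` lim_sup_set F2).
  split.
    by do 2?apply: measurableI => //; apply: measurableC; exact: mlim.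
  rewrite !setCI !setCK; apply/null_set_setU; rewrite ?null_set_setU//.
  - by apply: measurableU; [exact: measurableC|exact: mlim].
  - exact: mlim.
  - exact: measurableC.
  - exact: mlim.
  - exact: (walk_start ZP).
move=> om [[Som F1om] F2om].
have ev F : ~ @lim_sup_set Omega F om -> exists N, forall n, (N <= n)%N -> ~ F n om.
  move=> Fom; apply: contrapT => H; apply: Fom => N _.
  apply: contrapT => FN; apply: H; exists N => n Nn Fn; apply: FN.
  by exists n.
have [N1 N1P] := ev _ F1om; have [N2 N2P] := ev _ F2om.
exists (maxn N1 N2) => n; rewrite geq_max => /andP[n1 n2]; split.
  by rewrite leqNgt; apply/negP => h; apply: (N1P n n1).
by rewrite leqNgt; apply/negP => h; apply: (N2P n n2).
Qed.

End transience.

Theorem lemma3p2 (R : realType) (G : graph) (e : G) (f : floyd_function R)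
  (f_moment : cvgn (series (fun n : nat => n%:R * f n)))
  (p : G -> G -> R)
  (p_transition : transition_matrix p)
  (p_irr : uniformly_irreducible p)
  (p_moment : uniform_first_moment p)
  (v w : G) (p_radius : (spectral_radius p v w < 1)%E)
  (d : measure_display) (Omega : measurableType d) (Pr : probability Omega R)
  (x0 : G) (Z : nat -> Omega -> G)
  (Z_walk : random_walk p Pr x0 Z) :
  exists xi : Omega -> floyd_compactification e f,
    [/\ borel_measurable xi,
        forall om, floyd_boundary (xi om) &
        {ae Pr, forall om,
          (fun n => floyd_embedding e f (Z n om)) @ \oo --> xi om}].
Proof.
have [L L0 [D [mD PD] Dbal]] :=
  ae_ballistic e p_transition p_irr p_moment p_radius Z_walk.
have Dlim om : D om -> exists xi : floyd_compactification e f,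
    (fun n => floyd_embedding e f (Z n om)) @ \oo --> xi /\ floyd_boundary xi.
  by move=> /Dbal; exact: ballistic_cvg.
(* A boundary point is needed off D as well; D has probability 1, hence is not
   empty, and provides one. *)
have [om0 Dom0] : D !=set0.
  apply/set0P/eqP => D0; move: PD; rewrite D0 setC0 probability_setT.
  by move/eqP; rewrite onee_eq0.
have [a [_ ab]] := Dlim _ Dom0.
have /choice[xi xiP] om : exists y : floyd_compactification e f,
    [/\ D om -> (fun n => floyd_embedding e f (Z n om)) @ \oo --> y,
        ~ D om -> y = a & floyd_boundary y].
  have [Dom|Dom] := pselect (D om); last by exists a.
  by have [y [yl yb]] := Dlim _ Dom; exists y.
exists xi; split=> [|om|].
- apply: (@borel_measurable_lim _ _ _ _
    (fun n om => floyd_embedding e f (Z n om)) _ a D) => //.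
  + by move=> n B; exact: (measurable_walk_set Z_walk n (floyd_embedding e f @^-1` B)).
  + by move=> om; have [] := xiP om.
  + by move=> om; have [] := xiP om.
- by have [] := xiP om.
- exists (~` D); split=> //; first exact: measurableC.
  by apply: subsetC => om Dom /=; have [+ _ _] := xiP om; exact.
Qed.
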